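(* Let $\mathbb{F}$ be a field of characteristic $0$ and let $\mathfrak{g}$ be a finite-dimensional Lie algebra over $\mathbb{F}$. Suppose there is an $\mathbb{F}$-bilinear product $\mathfrak{g}\times\mathfrak{g}\to\mathfrak{g}$, $(u,v)\mapsto uv$, such that for all $u,v,w\in\mathfrak{g}$ $$uv-vu=[u,v]\qquad\text{and}\qquad [uv,w]+[u,wv]=0 .$$ Then $\mathfrak{g}$ is solvable. Consequently, every pseudo-Riemannian Lie algebra $(\mathfrak{g},(\ ,\ ))$ over $\mathbb{F}$ is solvable.
   Context: A pseudo-Riemannian Lie algebra over a field $\mathbb{F}$ with $\operatorname{char}\mathbb{F}\neq 2$ is a finite-dimensional Lie algebra $\mathfrak{g}$ with a non-degenerate symmetric bilinear form $(\ ,\ )$ and a bilinear product $(u,v)\mapsto uv$ on $\mathfrak{g}$ such that for all $u,v,w\in\mathfrak{g}$: (PR1) $uv-vu=[u,v]$; (PR2) $(uv,w)+(v,uw)=0$; (PR3) $[uv,w]+[u,wv]=0$. Conditions (PR1) and (PR2) determine the product uniquely from the bracket and the form: $2(uv,w)=([u,v],w)+([w,u],v)+([w,v],u)$. No associativity of the product is assumed. *)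

(* Defs.v *)
From HB Require Import structures.
From mathcomp Require Import all_boot all_order all_algebra.

Set Implicit Arguments.
Unset Strict Implicit.
Unset Printing Implicit Defensive.

Import GRing.Theory.
Local Open Scope ring_scope.

Section LieAlgebra.
Variables (F : fieldType) (g : vectType F).
Implicit Types (br mul : {bilinear g -> g -> g}) (U V W : {vspace g}).

Definition is_lie_bracket br : Prop :=
  (forall u, br u u = 0) /\
  (forall u v w, br u (br v w) + br v (br w u) + br w (br u v) = 0).

(* [U, V], the span of all brackets; lie_prodvP shows that it does not depend
   on the bases. *)
Definition lie_prodv br U V : {vspace g} :=
  <<[seq br u v | u <- vbasis U, v <- vbasis V]>>%VS.

Lemma lie_prodvP br U V W :
  reflect {in U & V, forall u v, br u v \in W} (lie_prodv br U V <= W)%VS.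
Proof.
apply: (iffP span_subvP) => [sUVW u v Uu Vv | sUVW _ /allpairsP[[u v] /= [Uu Vv ->]]].
  rewrite (coord_vbasis Uu) (coord_vbasis Vv) linear_sumlz memv_suml // => i _.
  rewrite linear_sumr memv_suml // => j _.
  rewrite linearZl_LR linearZr_LR !memvZ // sUVW //.
  by apply: allpairs_f; rewrite mem_nth ?size_tuple.
by apply: sUVW; apply: vbasis_mem.
Qed.

Definition lie_derived br (k : nat) : {vspace g} :=
  iter k (fun U => lie_prodv br U U) fullv.

Definition lie_solvable br : Prop := exists k, lie_derived br k = 0%VS.

Definition PR1 br mul : Prop :=
  forall u v, mul u v - mul v u = br u v.

Definition PR2 (form : {symmetric g}) mul : Prop :=
  forall u v w, form (mul u v) w + form v (mul u w) = 0.

Definition PR3 br mul : Prop :=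
  forall u v w, br (mul u v) w + br u (mul w v) = 0.

Definition pseudo_riemannian_lie br (form : {symmetric g}) mul : Prop :=
  [/\ (2%:R : F) != 0, is_lie_bracket br, nondegenerate form,
      PR1 br mul & PR2 form mul /\ PR3 br mul].

End LieAlgebra.

(* Main.v *)
(* Right multiplications D = (u |-> uv) satisfy [Dx, y] = -[x, Dy]; call such D
   skew.  After dividing by a maximal solvable ideal, g has no nonzero
   metabelian ideal, and in particular no center.  Then D^2 lies in the
   centroid.  Adjoin t with t^2 = D^2: the images of t + D and t - D are
   commuting subspaces, and Ito's argument for a sum of two abelian algebras
   yields [D^2 [x, y], [z, w]] = 0.  So the image of D^2 is a metabelian ideal
   and D^2 = 0.  By polarization skew maps anticommute, their composites are
   again skew, and a composite of three of them vanishes.  Their common kernel K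
   is an ideal, abelian because [k, k'] = kk' - k'k = 0; hence K = 0, and
   D D' D'' = 0 forces g = 0. *)
From HB Require Import structures.
Require Import Defs.
From mathcomp Require Import all_boot all_order all_algebra.
From mathcomp Require Import boolp ring.

Set Implicit Arguments.
Unset Strict Implicit.
Unset Printing Implicit Defensive.

Import GRing.Theory.
Local Open Scope ring_scope.

(** * Ito's exchange identity for two commuting images *)

Section CommutingDecomposition.
Variables (V : zmodType) (br : V -> V -> V) (P Q : V -> V).
Hypothesis br0 : forall x, br x 0 = 0.
Hypothesis brC : forall x y, br x y = - br y x.
Hypothesis brJ : forall x y z, br x (br y z) = br (br x y) z + br y (br x z).
Hypothesis brPQ : forall x y, br (P x) y = br x (Q y).
Hypothesis brPP : forall x y, br (P x) (P y) = 0.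
Hypothesis brQQ : forall x y, br (Q x) (Q y) = 0.

(* Ito's computation; the two values are exchanged by swapping x with x' and y
   with y' separately. *)
Lemma br_decomp_swap x y x' y' :
  br (P (br (P x) y)) (br (P x') y') = br (P (br (P x') y')) (br (P x) y).
Proof.
have br0l z : br 0 z = 0 by rewrite brC br0 oppr0.
(* As the image of [Q] is abelian, the left side becomes nested brackets with [P a] and [P a'],
   whose adjoint actions commute. *)
have swapx a b a' b' : br (P (br (P a) b)) (br (P a') b')
    = br (P (br (P a') b)) (br (P a) b').
  have E c c' : br (P (br (P c) b)) (br (P c') b')
      = - br (Q b) (br (P c) (br (P c') b')).
    apply/eqP; rewrite -addr_eq0 brPQ [br (P c) b]brPQ [br (P c) (br _ _)]brPQ.
    by rewrite -brJ brQQ br0.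
  by rewrite !E [br (P a) (br (P a') b')]brJ brPP br0l add0r.
have swapy a b a' b' : br (P (br (P a) b)) (br (P a') b')
    = br (P (br (P a) b')) (br (P a') b).
  have E c c' : br (P (br (P a) c)) (br (P a') c')
      = br (P a') (br (br a (Q c)) (Q c')).
    by rewrite brJ brPP br0l add0r [br (P _) c']brPQ [br (P a) c]brPQ.
  rewrite !E; congr (br _ _); have := brJ a (Q b) (Q b').
  by move/esym/eqP; rewrite brQQ br0 [br (Q b) _]brC subr_eq0 => /eqP.
by rewrite swapx swapy.
Qed.

End CommutingDecomposition.

Section Coordinates.
Import VectorInternalTheory.
Variables (F : fieldType) (g : vectType F).
Implicit Types u v : g.

Definition coor u : 'rV[F]_(dim g) := v2r u.
Lemma coor_inj : injective coor. Proof. exact: can_inj v2rK. Qed.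
Lemma coorD u v : coor (u + v) = coor u + coor v. Proof. exact: linearD. Qed.
Lemma coorN u : coor (- u) = - coor u. Proof. exact: linearN. Qed.
Lemma coor0 : coor 0 = 0. Proof. exact: linear0. Qed.

End Coordinates.

(** Expands brackets, then checks the additive identity coordinatewise, where [ring] applies. *)
Ltac vect_ring :=
  rewrite ?(linearDr, linearDl, linearNr, linearNl, linear0r, linear0l);
  apply: coor_inj; apply/rowP => ?; rewrite ?(coorD, coorN, coor0) ?mxE;
  ring.

(** * Maximal subspaces and subspaces cut out by predicates *)

Section Subspaces.
Variables (F : fieldType) (g : vectType F).

Lemma exists_maximal_vspace (P : {vspace g} -> Prop) U0 :
  P U0 -> exists2 U, P U & forall V, (U <= V)%VS -> P V -> (V <= U)%VS.
Proof.
move=> PU0; pose p n := `[< exists2 U, P U & \dim U = n >].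
have [|n /asboolP[U _ <-]|n /asboolP[U PU dU] nmax] := @ex_maxnP p (\dim {:g}).
- by exists (\dim U0); apply/asboolP; exists U0.
- exact/dimvS/subvf.
exists U => // V sUV PV; rewrite -(geq_leqif (dimv_leqif_sup sUV)) dU.
by apply/nmax/asboolP; exists V.
Qed.

(** Take a maximal subspace inside [S]; adjoining the line of any [x] in [S] stays inside [S]. *)
Lemma exists_vspace_of_pred (S : g -> Prop) :
  S 0 -> (forall a x y, S x -> S y -> S (a *: x + y)) ->
  exists U : {vspace g}, forall x, x \in U <-> S x.
Proof.
move=> S0 Slin; pose P (U : {vspace g}) := forall x, x \in U -> S x.
have [|U PU Umax] := @exists_maximal_vspace P 0%VS.
  by move=> x; rewrite memv0 => /eqP ->.
exists U => x; split=> [/PU //|Sx].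
suff /Umax/subvP: P (U + <[x]>)%VS.
  by apply; [exact: addvSl | apply/(subvP (addvSr _ _))/memv_line].
by move=> _ /memv_addP[u /PU Su [_ /vlineP[k ->] ->]]; rewrite addrC; apply: Slin.
Qed.

End Subspaces.

(** * Skew maps of an algebra without nonzero metabelian ideals *)

Section NoMetabelianIdeal.
Variables (F : fieldType) (g : vectType F) (br mul : {bilinear g -> g -> g}).
Hypothesis F2 : 2%:R != 0 :> F.
Hypothesis lie_br : is_lie_bracket br.
Hypothesis no_metab : forall U : {vspace g},
  (forall x y, y \in U -> br x y \in U) ->
  (forall a b c d, a \in U -> b \in U -> c \in U -> d \in U ->
     br (br a b) (br c d) = 0) ->
  U = 0%VS.

Lemma lie_brC x y : br x y = - br y x.
Proof.
case: lie_br => br0 _; apply/eqP; rewrite -addr_eq0.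
by have := br0 (x + y); rewrite linearDr !linearDl !br0 add0r addr0 addrC => ->.
Qed.

Lemma lie_brJ x y z : br x (br y z) = br (br x y) z + br y (br x z).
Proof.
case: lie_br => _ /(_ x y z) /eqP.
rewrite -addrA addr_eq0 opprD => /eqP ->.
by rewrite [br z x]lie_brC linearNr [br z (br x y)]lie_brC !opprK addrC.
Qed.

Lemma double0 (x : g) : x + x = 0 -> x = 0.
Proof. by move/eqP; rewrite -mulr2n -scaler_nat scaler_eq0 (negPf F2) => /eqP. Qed.

(** A central element spans an abelian ideal. *)
Lemma centerless z : (forall x, br z x = 0) -> z = 0.
Proof.
move=> cz; apply/eqP; rewrite -memv0 -(@no_metab <[z]>%VS) ?memv_line //.
  by move=> x y /vlineP[k ->]; rewrite lie_brC linearZl_LR cz scaler0 oppr0 mem0v.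
move=> a b c d /vlineP[k ->] _ _ _.
by rewrite linearZl_LR cz scaler0 linear0l.
Qed.

Definition bracket_skew (D : g -> g) := forall x y, br (D x) y = - br x (D y).

Section Skew.
Variable D : 'End(g).
Hypothesis skD : bracket_skew D.

Lemma skew_brl a b z : br (D (br a b)) z = br a (br (D b) z) - br b (br (D a) z).
Proof.
rewrite skD -[br (br a b) _](addrK (br b (br a (D z)))) -lie_brJ.
by rewrite !skD; vect_ring.
Qed.

Lemma skew_sqr_br x y : D (D (br x y)) = br (D (D x)) y.
Proof.
apply/eqP; rewrite -subr_eq0; apply/eqP/centerless => z; rewrite linearBl.
have E1 : br (D (D (br x y))) z = br x (br (D (D y)) z) - br y (br (D (D x)) z).
  by rewrite !skD !opprK [br x (br _ _)]lie_brJ addrK.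
(* By skewness [Dy, x] = [Dx, y]; expand [D[Dx, y], z] in both ways. *)
have := skew_brl (D x) y z; have := skew_brl (D y) x z.
have -> : br (D y) x = br (D x) y by rewrite skD -lie_brC.
move=> -> E2.
have E3 : br (br (D x) (D y)) z = br (D x) (br (D y) z) - br (D y) (br (D x) z).
  by rewrite [br (D x) (br _ _)]lie_brJ addrK.
rewrite E1 [br (D (D x)) y]skD linearNl opprK E3.
move/eqP: E2; rewrite subr_eq => /eqP ->; vect_ring.
Qed.

(* The bracket of g[t]/(t^2 - D^2), with (a, b) standing for a + b t; it is
   bilinear over t because D^2 lies in the centroid. *)
Let dbr (u v : g * g) : g * g :=
  (br u.1 v.1 + D (D (br u.2 v.2)), br u.1 v.2 + br u.2 v.1).
(* t + D and t - D *)
Let P (u : g * g) : g * g := (D u.1 + D (D u.2), u.1 + D u.2).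
Let Q (u : g * g) : g * g := (D (D u.2) - D u.1, u.1 - D u.2).

Lemma skew_sqr_metabelian x y z w : br (D (D (br x y))) (br z w) = 0.
Proof.
have DD a b : D (a + b) = D a + D b by exact: linearD.
have DN a : D (- a) = - D a by exact: linearN.
have Er a b : br a (D (D b)) = D (D (br a b)) by rewrite skew_sqr_br !skD opprK.
have El a b : br (D (D a)) b = D (D (br a b)) by rewrite skew_sqr_br.
have dbr0 a : dbr a 0 = 0.
  by rewrite /dbr /= !linear0r !linear0 !addr0.
have dbrC a b : dbr a b = - dbr b a.
  rewrite /dbr [br a.1 b.1]lie_brC [br a.2 b.2]lie_brC [br a.1 b.2]lie_brC.
  rewrite [br a.2 b.1]lie_brC; congr pair; rewrite /= ?DN; vect_ring.
have dbrJ a b c : dbr a (dbr b c) = dbr (dbr a b) c + dbr b (dbr a c).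
  rewrite /dbr; congr pair; rewrite /= !(linearDl, linearDr, DD, El, Er);
    rewrite ![br a.1 (br _ _)]lie_brJ ![br a.2 (br _ _)]lie_brJ ?DD; vect_ring.
have PQ a b : dbr (P a) b = dbr a (Q b).
  rewrite /dbr /P /Q; congr pair;
    rewrite /= !(linearDl, linearDr, linearNr, DD, DN, El, Er) !skD ?DN; vect_ring.
have QP0 a : Q (P a) = 0.
  rewrite /P /Q; congr pair; rewrite /= !DD; vect_ring.
have PQ0 a : P (Q a) = 0.
  rewrite /P /Q; congr pair; rewrite /= !(DD, DN); vect_ring.
have PP a b : dbr (P a) (P b) = 0 by rewrite PQ QP0 dbr0.
have QQ a b : dbr (Q a) (Q b) = 0 by rewrite -PQ PQ0 dbrC dbr0 oppr0.
have skC a b : br (D a) b = br (D b) a by rewrite skD -lie_brC.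
(* The coefficient of t in br_decomp_swap. *)
have key a b c d : br (D (D (br a b))) (br c d) = - br (br (D a) b) (br (D c) d).
  have := br_decomp_swap dbr0 dbrC dbrJ PQ PP QQ (a, 0) (b, 0) (c, 0) (d, 0).
  rewrite /P /dbr => /(congr1 snd) /=.
  rewrite !(linear0r, linear0l, linear0, addr0, add0r).
  (* The terms [br (D f) m'] and [br (D m) f'] occur on both sides and cancel; the remaining terms
     change sign under the swap, leaving twice the claim. *)
  set f := br (D a) b; set m := br a b; set f' := br (D c) d; set m' := br c d.
  rewrite !linearDl ![br (D (D _)) _]El [br (D f') m]skC [br (D m') f]skC.
  rewrite [br m' m]lie_brC [br f' f]lie_brC DN DN => /eqP.
  rewrite -subr_eq0 => /eqP H; apply/eqP; rewrite -addr_eq0; apply/eqP/double0.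
  by rewrite -[RHS]H; vect_ring.
(* The right-hand side of key is symmetric in z and w, the left-hand side
   antisymmetric. *)
apply: double0.
have := key x y w z; rewrite [br (D w) z]skC -key [br w z]lie_brC linearNr.
by move=> {1}<-; rewrite addNr.
Qed.

Lemma skew_sqr0 x : D (D x) = 0.
Proof.
suff /vspaceP/(_ (D (D x))) : limg (D \o D)%VF = 0%VS.
  by rewrite memv0 -comp_lfunE memv_img ?memvf // => /esym/eqP.
apply: no_metab => [y _ /memv_imgP[u _ ->]|].
  rewrite comp_lfunE; have -> : br y (D (D u)) = (D \o D)%VF (br y u).
    by rewrite comp_lfunE skew_sqr_br !skD opprK.
  by rewrite memv_img ?memvf.
move=> _ b c d /memv_imgP[u _ ->] _ _ _.
by rewrite comp_lfunE -skew_sqr_br skew_sqr_metabelian.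
Qed.

End Skew.

Lemma skewD (D1 D2 : 'End(g)) :
  bracket_skew D1 -> bracket_skew D2 -> bracket_skew (D1 + D2)%R.
Proof.
by move=> s1 s2 x y; rewrite !add_lfunE linearDl linearDr s1 s2 opprD.
Qed.

Lemma skew_anticomm (D1 D2 : 'End(g)) x :
  bracket_skew D1 -> bracket_skew D2 -> D1 (D2 x) = - D2 (D1 x).
Proof.
move=> s1 s2; apply/eqP; rewrite -addr_eq0; apply/eqP.
have := skew_sqr0 (skewD s1 s2) x.
rewrite !add_lfunE (linearD D1) (linearD D2) /=.
by rewrite (skew_sqr0 s1) (skew_sqr0 s2) add0r addr0.
Qed.

(** Moving both maps across the bracket reverses their order with sign +1; anticommutation restores
    the order and supplies the minus sign. *)
Lemma skew_comp (D1 D2 : 'End(g)) :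
  bracket_skew D1 -> bracket_skew D2 -> bracket_skew (D1 \o D2)%VF.
Proof.
move=> s1 s2 x y.
by rewrite !comp_lfunE s1 s2 opprK (skew_anticomm _ s2 s1) linearNr.
Qed.

(** [D3] anticommutes with the skew map [D1 \o D2], yet passing [D1] and [D2] one at a time costs
    two signs. *)
Lemma skew_comp3 (D1 D2 D3 : 'End(g)) x :
  bracket_skew D1 -> bracket_skew D2 -> bracket_skew D3 -> D1 (D2 (D3 x)) = 0.
Proof.
move=> s1 s2 s3; apply: double0.
have := skew_anticomm x (skew_comp s1 s2) s3; rewrite !comp_lfunE => {1}->.
rewrite (skew_anticomm _ s3 s1) opprK (skew_anticomm _ s3 s2) linearN.
exact: addNr.
Qed.

(** Holds because [br z] is a derivation; it makes the common kernel of the skew maps an ideal. *)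
Lemma skew_ad (D : 'End(g)) z :
  bracket_skew D -> bracket_skew ((linfun (br z) \o D) - (D \o linfun (br z)))%VF.
Proof.
move=> sD x y; rewrite !add_lfunE !opp_lfunE !comp_lfunE !lfunE /=.
have E1 : br (br z (D x)) y = br z (br (D x) y) - br (D x) (br z y).
  by rewrite [br z (br _ _)]lie_brJ addrK.
have E2 : br (br z x) (D y) = br z (br x (D y)) - br x (br z (D y)).
  by rewrite [br z (br _ _)]lie_brJ addrK.
by rewrite linearBl linearBr E1 [br (D (br _ _)) y]sD E2 !sD; vect_ring.
Qed.

Lemma skew_common_kernel : exists K : {vspace g},
  forall x, x \in K <-> forall D : 'End(g), bracket_skew D -> D x = 0.
Proof.
apply: exists_vspace_of_pred => [D _|a x y Kx Ky D sD]; first exact: linear0.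
by rewrite linearP /= Kx // Ky // scaler0 addr0.
Qed.

Hypothesis PR1_mul : PR1 br mul.
Hypothesis PR3_mul : PR3 br mul.

Lemma skew_rmul v : bracket_skew (linfun (applyr mul v)).
Proof. by move=> x y; rewrite !lfunE /=; apply/eqP; rewrite -addr_eq0 PR3_mul. Qed.

Lemma no_metabelian_ideal_trivial (x : g) : x = 0.
Proof.
have [K KP] := skew_common_kernel.
have K0 y : (forall D : 'End(g), bracket_skew D -> D y = 0) -> y = 0.
  move=> Ky; apply/eqP; rewrite -memv0 -(@no_metab K); first exact/KP.
    move=> z k /KP Kk; apply/KP => D sD.
    have := Kk _ (skew_ad z sD).
    rewrite !add_lfunE !opp_lfunE !comp_lfunE !lfunE /= Kk // linear0r add0r.
    by move/eqP; rewrite oppr_eq0 => /eqP.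
  have Kmul k v : k \in K -> mul k v = 0.
    by move/KP/(_ _ (skew_rmul v)); rewrite lfunE.
  move=> a b c d Ka Kb _ _.
  by rewrite -[br a b]PR1_mul !Kmul // subrr linear0l.
(* Each use of [K0] puts one more arbitrary skew map in front of [x]. *)
by do 3![apply: (K0) => ? ?]; apply: skew_comp3.
Qed.

End NoMetabelianIdeal.

(** * The quotient by a subspace and its induced products *)

Section Quotient.
Variables (F : fieldType) (g : vectType F) (R : {vspace g}).

(* g / R is realised on a complement of R. *)
Definition quotv := subvs_of R^C.

Definition quot_pi (x : g) : quotv := vsproj R^C (daddv_pi R^C R x).

Lemma quot_pi_is_linear : linear quot_pi.
Proof. by move=> a x y; rewrite /quot_pi !linearP. Qed.

HB.instance Definition _ :=
  GRing.isLinear.Build F g quotv *:%R quot_pi quot_pi_is_linear.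

Lemma capCv : (R^C :&: R)%VS = 0%VS.
Proof. by rewrite capvC capv_compl. Qed.

Lemma quot_piK (q : quotv) : quot_pi (vsval q) = q.
Proof. by rewrite /quot_pi daddv_pi_id ?capCv ?subvsP // vsvalK. Qed.

Lemma quot_val_pi x : vsval (quot_pi x) - x \in R.
Proof.
rewrite /quot_pi vsprojK ?memv_pi //.
have xf : x \in (R^C + R)%VS by rewrite addvC addv_complf memvf.
rewrite -{2}(daddv_pi_add capCv xf) opprD addrA subrr add0r memvN.
exact: memv_pi.
Qed.

Lemma quot_pi_eq0 x : (quot_pi x == 0) = (x \in R).
Proof.
apply/eqP/idP => [x0|xR].
  by have := quot_val_pi x; rewrite x0 linear0 add0r memvN.
have xf : x \in (R^C + R)%VS by rewrite addvC addv_complf memvf.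
have := daddv_pi_add capCv xf.
rewrite [daddv_pi R _ x]daddv_pi_id ?capv_compl //.
by move=> /(canRL (addrK _)); rewrite subrr /quot_pi => ->; rewrite linear0.
Qed.

Section InducedProduct.
Variable f : {bilinear g -> g -> g}.

Definition quot_bil (p q : quotv) : quotv := quot_pi (f (vsval p) (vsval q)).

Lemma quot_bil_is_bilinear : bilinear_for *:%R *:%R quot_bil.
Proof.
by split=> [u a x y|u a x y]; rewrite /quot_bil linearP ?linearPl ?linearPr linearP.
Qed.

HB.instance Definition _ :=
  bilinear_isBilinear.Build F quotv quotv quotv *:%R *:%R quot_bil
    quot_bil_is_bilinear.

End InducedProduct.

(** The chosen representative of the class of [x] differs from [x] by an element of [R]. *)
Lemma quot_pi_val (h : {linear g -> g}) x :
  (forall y, y \in R -> h y \in R) -> quot_pi (h (vsval (quot_pi x))) = quot_pi (h x).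
Proof.
move=> hR; apply/eqP; rewrite -subr_eq0 -linearB quot_pi_eq0 -linearB.
exact/hR/quot_val_pi.
Qed.

End Quotient.

(** * Derived series of a subspace *)

Section DerivedSeries.
Variables (F : fieldType) (g : vectType F) (br : {bilinear g -> g -> g}).
Implicit Types U V : {vspace g}.

Definition derived_from U k := iter k (fun V => lie_prodv br V V) U.

Lemma derived_fromS U V k : (U <= V)%VS -> (derived_from U k <= derived_from V k)%VS.
Proof.
move=> sUV; elim: k => //= k /subvP IH; apply/lie_prodvP => u v Uu Uv.
by have /lie_prodvP := subvv (lie_prodv br (derived_from V k) (derived_from V k));
  apply; apply: IH.
Qed.

(** With one bracket fixed, the condition on the other is linear, so it can be checked on generators
    as containment in a preimage of [V]. *)
Lemma derived_from2 U V :
  (forall a b c d, a \in U -> b \in U -> c \in U -> d \in U ->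
     br (br a b) (br c d) \in V) -> (derived_from U 2 <= V)%VS.
Proof.
move=> UV; apply/lie_prodvP => u v Uu Uv.
suff /subvP/(_ u Uu) : (lie_prodv br U U <= linfun (applyr br v) @^-1: V)%VS.
  by rewrite -memv_preim lfunE.
apply/lie_prodvP => a b Ua Ub; rewrite -memv_preim lfunE /=.
suff /subvP/(_ v Uv) : (lie_prodv br U U <= linfun (br (br a b)) @^-1: V)%VS.
  by rewrite -memv_preim lfunE.
by apply/lie_prodvP => c d Uc Ud; rewrite -memv_preim lfunE; apply: UV.
Qed.

End DerivedSeries.

(* R need not be stable under mul, so quot_bil mul may depend on the chosen
   complement; (PR1) and (PR3) nevertheless descend, since mul only enters them
   linearly or inside a bracket, for which R is an ideal. *)
Lemma PR1_PR3_solvable (F : fieldType) (g : vectType F)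
    (br mul : {bilinear g -> g -> g}) :
  2%:R != 0 :> F -> is_lie_bracket br -> PR1 br mul -> PR3 br mul ->
  lie_solvable br.
Proof.
move=> F2 lie_br pr1 pr3.
pose ideal (U : {vspace g}) := forall x y, y \in U -> br x y \in U.
pose P U := ideal U /\ exists k, derived_from br U k = 0%VS.
have [|R [idR [k Rk]] Rmax] := @exists_maximal_vspace F g P 0%VS.
  by split; [move=> x y; rewrite !memv0 => /eqP ->; rewrite linear0r | exists 0].
have idRl x y : x \in R -> br x y \in R.
  by move=> xR; rewrite (lie_brC lie_br) memvN idR.
have piMr a b : quot_pi R (br a (vsval (quot_pi R b))) = quot_pi R (br a b).
  by apply: quot_pi_val => y; apply: idR.
have piMl a b : quot_pi R (br (vsval (quot_pi R a)) b) = quot_pi R (br a b).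
  by apply: (@quot_pi_val _ _ _ (applyr br b)) => y; apply: idRl.
suff sR : (fullv <= R)%VS.
  by exists k; apply/eqP; rewrite -subv0 -Rk; apply: derived_fromS.
apply/subvP => x _; rewrite -quot_pi_eq0; apply/eqP.
apply: (@no_metabelian_ideal_trivial F (quotv R) (quot_bil br) (quot_bil mul) F2).
- case: lie_br => br0 brJ; split=> [u|u v w]; first by rewrite /= /quot_bil br0 linear0.
  by rewrite /= /quot_bil !piMr -!linearD brJ linear0.
- move=> U idU metabU.
  (* Two derived steps take the preimage of [U] into [R] and [k] more to 0, so by maximality it lies
     in [R]. *)
  pose I := (linfun (@quot_pi F g R) @^-1: U)%VS.
  have memI y : (y \in I) = (quot_pi R y \in U) by rewrite -memv_preim lfunE.
  have piM a b : quot_pi R (br a b) = quot_bil br (quot_pi R a) (quot_pi R b).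
    by rewrite /= /quot_bil piMl piMr.
  have sRI : (R <= I)%VS.
    by apply/subvP => y; rewrite memI -quot_pi_eq0 => /eqP ->; apply: mem0v.
  have /Rmax-/(_ sRI)/subvP sIR : P I.
    split=> [y z|]; first by rewrite !memI piM; apply: idU.
    exists (k + 2)%N; apply/eqP; rewrite -subv0 -Rk /derived_from iterD.
    apply/derived_fromS/derived_from2 => a b c d.
    by rewrite !memI => *; rewrite -quot_pi_eq0 !piM; apply/eqP/metabU.
  apply/eqP; rewrite -subv0; apply/subvP => q Uq.
  have /sIR : vsval q \in I by rewrite memI quot_piK.
  by rewrite -quot_pi_eq0 quot_piK memv0.
- by move=> u v; rewrite /= /quot_bil -linearB pr1.
- by move=> u v w; rewrite /= /quot_bil piMl piMr -linearD pr3 linear0.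
Qed.

Theorem theorem2p5 (F : fieldType) (charF0 : [pchar F] =i pred0)
    (g : vectType F) (br : {bilinear g -> g -> g}) :
  (is_lie_bracket br ->
   (exists mul : {bilinear g -> g -> g}, PR1 br mul /\ PR3 br mul) ->
   lie_solvable br)
  /\
  (forall (form : {symmetric g}) (mul : {bilinear g -> g -> g}),
     pseudo_riemannian_lie br form mul -> lie_solvable br).
Proof.
split=> [lie_br [mul [pr1 pr3]]|form mul [F2 lie_br _ pr1 [_ pr3]]].
  by apply: (PR1_PR3_solvable _ lie_br pr1 pr3); move/pcharf0P: charF0 => ->.
exact: PR1_PR3_solvable pr1 pr3.
Qed.
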